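(* Let $h_1,h_2\in\mathbb{C}$ with $h=\frac{h_1+h_2}{2}\neq0$, and put $\phi=h_1/h$, $\varphi=h_2/h$. If $M=\begin{pmatrix} x&\mu\\ \nu&y\end{pmatrix}\in\mathcal{M}_{h_1,h_2}$, then for every positive integer $n$ the matrix $M^n$ has the form $$M^n=\begin{pmatrix} x^n-\mu\nu F_n & \mu G_n\\ \nu G_n^\tau & y^n-\nu\mu F_n^\tau\end{pmatrix},$$ where $$F_n=F_n(x,y,\phi,\varphi)=\frac{x^n}{2(x-y-\varphi)}-\frac{(x+\phi+\varphi)^n}{2(x-y+\phi)}-\frac{(y+\varphi)^n}{(x-y+\phi)(x-y-\varphi)},$$ $$G_n=G_n(x,y,\phi)=\frac{(x+\phi)^n-y^n}{x-y+\phi}.$$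
   Context: Here $x,y,\mu,\nu$ are elements of a unital associative $\mathbb{C}$-algebra, and $M\in\mathcal{M}_{h_1,h_2}$ means that they satisfy $$[x,\mu]=\phi\mu,\quad [y,\mu]=\phi\mu,\quad \mu^2=0,\quad [x,\nu]=\varphi\nu,\quad [y,\nu]=\varphi\nu,\quad \nu^2=0,\quad xy-yx=0,\quad \mu\nu+\nu\mu=0,$$ with $[u,v]=uv-vu$, $\phi=\frac{2h_1}{h_1+h_2}$, $\varphi=\frac{2h_2}{h_1+h_2}$ (so $\phi+\varphi=2$). The transformation $\tau$ is the exchange $\tau(x,y,\mu,\nu,h_1,h_2)=(y,x,\nu,\mu,h_2,h_1)$; thus $F_n^\tau=F_n(y,x,\varphi,\phi)$ and $G_n^\tau=G_n(y,x,\varphi)$. The expressions $F_n$ and $G_n$ are polynomials in the commuting elements $x,y$: the divisions are exact. *)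

(* Defs.v *)
From HB Require Import structures.
From mathcomp Require Import all_boot all_order all_algebra.
From mathcomp Require Import complex reals.

Set Implicit Arguments.
Unset Strict Implicit.
Unset Printing Implicit Defensive.

Import GRing.Theory.
Local Open Scope ring_scope.

Definition mx2 (A : Type) (a b c d : A) : 'M[A]_2 :=
  \matrix_(i < 2, j < 2)
    if i == 0 then (if j == 0 then a else b) else (if j == 0 then c else d).

Definition bracket (A : pzRingType) (u v : A) : A := u * v - v * u.

Definition calM (C : fieldType) (A : algType C) (h1 h2 : C) (M : 'M[A]_2)
    : Prop :=
  let x := M 0 0 in let mu := M 0 1 in
  let nu := M 1 0 in let y := M 1 1 in
  let phi := 2 * h1 / (h1 + h2) in
  let vphi := 2 * h2 / (h1 + h2) in
  [/\ bracket x mu = phi *: mu, bracket y mu = phi *: mu & mu ^+ 2 = 0] /\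
  [/\ bracket x nu = vphi *: nu, bracket y nu = vphi *: nu & nu ^+ 2 = 0] /\
  [/\ x * y - y * x = 0 & mu * nu + nu * mu = 0].

(* F_n and G_n are first formed in a field K, where the divisions make sense;
   K will be the field C(X, Y) of rational functions. *)
Definition Fexpr (K : fieldType) (n : nat) (x y phi vphi : K) : K :=
  x ^+ n / (2 * (x - y - vphi))
  - (x + phi + vphi) ^+ n / (2 * (x - y + phi))
  - (y + vphi) ^+ n / ((x - y + phi) * (x - y - vphi)).

Definition Gexpr (K : fieldType) (n : nat) (x y phi : K) : K :=
  ((x + phi) ^+ n - y ^+ n) / (x - y + phi).

(* C[X, Y] is {poly {poly C}}, with X the outer and Y the inner variable. *)
Definition ratfun (C : fieldType) : fieldType := {fraction {poly {poly C}}}.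

Definition ratX (C : fieldType) : ratfun C := tofrac 'X.
Definition ratY (C : fieldType) : ratfun C := tofrac ('X%:P).
Definition ratC (C : fieldType) (c : C) : ratfun C := tofrac (c%:P%:P).

(* The value p(x, y); the image of X^i Y^j is y ^+ j * x ^+ i, so this is a
   genuine substitution as soon as x and y commute. *)
Definition eval2 (C : fieldType) (A : algType C) (p : {poly {poly C}})
    (x y : A) : A :=
  (map_poly (horner_alg y) p).[x].

(* Main.v *)
(** Commuting x and y past mu and nu turns M^(n+1) = M^n M into the recursions
    G_(n+1) = (x + phi)^n + G_n y and F_(n+1) = x F_n - G_n(x + vphi, y + vphi),
    the terms in mu nu mu and nu mu nu being zero.  Starting from F_0 = G_0 = 0
    they define polynomials, and since phi + vphi = 2 the closed forms satisfy
    the same recursions in the field of rational functions. *)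
Require Import Defs.
From HB Require Import structures.
From mathcomp Require Import all_boot all_order all_algebra.
From mathcomp Require Import complex reals.
From mathcomp Require Import ring.

Set Implicit Arguments.
Unset Strict Implicit.
Unset Printing Implicit Defensive.

Import GRing.Theory.
Local Open Scope ring_scope.

(* If a and b commute, (a - b) * geo a b n = a ^+ n - b ^+ n. *)
Fixpoint geo (R : pzRingType) (a b : R) (n : nat) : R :=
  if n is m.+1 then a ^+ m + geo a b m * b else 0.

(* F_n is geo2 x (x + phi + vphi) (y + vphi) n. *)
Fixpoint geo2 (R : pzRingType) (x a b : R) (n : nat) : R :=
  if n is m.+1 then geo2 x a b m * x - geo a b m else 0.

Lemma rmorph_geo (R S : pzRingType) (f : {rmorphism R -> S}) (a b : R) n :
  f (geo a b n) = geo (f a) (f b) n.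
Proof.
by elim: n => [|n IHn] /=; rewrite ?rmorph0 // rmorphD rmorphM rmorphXn IHn.
Qed.

Lemma rmorph_geo2 (R S : pzRingType) (f : {rmorphism R -> S}) (x a b : R) n :
  f (geo2 x a b n) = geo2 (f x) (f a) (f b) n.
Proof.
elim: n => [|n IHn] /=; first exact: rmorph0.
by rewrite rmorphB rmorphM rmorph_geo IHn.
Qed.

(** The relation [a, m] = c m says a m = m (a + c), so m passes any power of a at the price of a
    shift; below m is [mu] or [nu], and the next two lemmas extend this to [geo] and [geo2]. *)
Lemma intertwineX (R : pzRingType) (m a a' : R) n :
  a * m = m * a' -> a ^+ n * m = m * a' ^+ n.
Proof.
move=> am; elim: n => [|n IHn]; first by rewrite !expr0 mul1r mulr1.
by rewrite exprSr -mulrA am mulrA IHn -mulrA -exprSr.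
Qed.

Lemma intertwine_geo (R : pzRingType) (m a b a' b' : R) n :
  a * m = m * a' -> b * m = m * b' -> geo a b n * m = m * geo a' b' n.
Proof.
move=> am bm; elim: n => [|n IHn] /=; first by rewrite mul0r mulr0.
by rewrite mulrDl mulrDr (intertwineX _ am) -mulrA bm mulrA IHn mulrA.
Qed.

Lemma intertwine_geo2 (R : pzRingType) (m x a b x' a' b' : R) n :
  x * m = m * x' -> a * m = m * a' -> b * m = m * b' ->
  geo2 x a b n * m = m * geo2 x' a' b' n.
Proof.
move=> xm am bm; elim: n => [|n IHn] /=; first by rewrite mul0r mulr0.
by rewrite mulrBl mulrBr (intertwine_geo _ am bm) -mulrA xm mulrA IHn mulrA.
Qed.

Lemma geo_closed (K : fieldType) (x y p : K) n :
  x - y + p != 0 -> geo (x + p) y n = Gexpr n x y p.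
Proof.
move=> d_neq0; elim: n => [|n IHn] /=.
  by rewrite /Gexpr !expr0 subrr mul0r.
by rewrite IHn /Gexpr !exprSr; field.
Qed.

(** The subtracted [geo] is G_n at (x + v, y + v), a translation that keeps x - y and hence the
    denominator x - y + p. The sum p + v = 2 cancels the constant 2 in [Fexpr], both in F_0 = 0 and
    in the coefficient of (x + p + v)^n. *)
Lemma geo2_closed (K : fieldType) (x y p v : K) n :
  2%:R != 0 :> K -> p + v = 2 -> x - y + p != 0 -> x - y - v != 0 ->
  geo2 x (x + p + v) (y + v) n = Fexpr n x y p v.
Proof.
(* Eliminating p builds the constraint into the expressions that [field] has to normalise. *)
move=> two_neq0 pv2 d1 d2; have -> : p = 2 - v by rewrite -pv2 addrK.
have {}d1 : x - y + (2 - v) != 0 by rewrite -pv2 addrK.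
elim: n => [|n IHn] /=.
  by rewrite /Fexpr !expr0; field; rewrite d1 d2 two_neq0.
rewrite IHn; have -> : x + (2 - v) + v = x + v + (2 - v) by ring.
rewrite geo_closed; last by have -> : x + v - (y + v) = x - y by ring.
rewrite /Fexpr /Gexpr !exprSr.
have -> : x + v - (y + v) + (2 - v) = x - y + (2 - v) by ring.
have -> : x + (2 - v) + v = x + v + (2 - v) by ring.
by field; rewrite d1 d2 two_neq0.
Qed.

Lemma mul_mx2 (A : pzRingType) (a b c d a' b' c' d' : A) :
  mx2 a b c d *m mx2 a' b' c' d' =
  mx2 (a * a' + b * c') (a * b' + b * d') (c * a' + d * c') (c * b' + d * d').
Proof.
apply/matrixP => i j; rewrite !mxE !big_ord_recl big_ord0 addr0 !mxE /=.
by case: (i == 0); case: (j == 0).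
Qed.

(** The shifts p and v are ring elements commuting with [mu] and [nu]; they will be the scalars phi
    and varphi. *)
Lemma expr_mx2 (A : nzRingType) (x y mu nu p v : A) n :
  x * mu = mu * (x + p) -> y * mu = mu * (y + p) -> mu * mu = 0 ->
  x * nu = nu * (x + v) -> y * nu = nu * (y + v) -> nu * nu = 0 ->
  p * mu = mu * p -> p * nu = nu * p -> v * mu = mu * v -> v * nu = nu * v ->
  mu * nu = - (nu * mu) ->
  mx2 x mu nu y ^+ n =
  mx2 (x ^+ n - mu * nu * geo2 x (x + p + v) (y + v) n) (mu * geo (x + p) y n)
      (nu * geo (y + v) x n) (y ^+ n - nu * mu * geo2 y (y + v + p) (x + p) n).
Proof.
move=> xmu ymu mu2 xnu ynu nu2 pmu pnu vmu vnu munu.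
have shift (a m c q : A) : a * m = m * (a + c) -> q * m = m * q ->
    (a + q) * m = m * (a + q + c).
  by move=> am qm; rewrite mulrDl am qm -mulrDr addrAC.
elim: n => [|n IHn].
  rewrite !expr0 /= !mulr0 !subr0; apply/matrixP => i j.
  by rewrite !mxE; case: i j => [[|[|i]] // hi] [[|[|j]] // hj].
(* Anticommutation brings the two equal factors together, where the square vanishes. *)
have munumu : mu * nu * mu = 0.
  by rewrite munu mulNr -mulrA mu2 mulr0 oppr0.
have numunu : nu * mu * nu = 0.
  by rewrite -[nu * mu]opprK -munu mulNr -mulrA nu2 mulr0 oppr0.
have xpnu := shift _ _ _ _ xnu pnu; have yvmu := shift _ _ _ _ ymu vmu.
have xpvmu : (x + p + v) * mu = mu * (x + p + v + p).
  by apply: (shift) => //; apply: shift.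
have yvpnu : (y + v + p) * nu = nu * (y + v + p + v).
  by apply: (shift) => //; apply: shift.
rewrite exprSr IHn [LHS]mul_mx2 /= !exprSr; congr mx2.
(* On the diagonal, moving [nu] left across G_n shifts both arguments by v, which yields the
   subtracted term of [geo2]. *)
- rewrite mulrBl -[mu * _ * nu]mulrA (intertwine_geo _ xpnu ynu).
  by rewrite mulrBr opprB -!mulrA addrA addrAC.
(* Off the diagonal, moving [mu] left across F_n exposes [mu * nu * mu], so only x^n mu = mu (x +
   p)^n and G_n y survive. *)
- rewrite mulrBl -[mu * nu * _ * mu]mulrA.
  rewrite (intertwine_geo2 _ xmu xpvmu yvmu) [mu * nu * (mu * _)]mulrA munumu.
  by rewrite mul0r subr0 (intertwineX _ xmu) mulrDr mulrA.
- rewrite mulrBl -[nu * mu * _ * nu]mulrA.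
  rewrite (intertwine_geo2 _ ynu yvpnu xpnu) [nu * mu * (nu * _)]mulrA numunu.
  by rewrite mul0r subr0 (intertwineX _ ynu) mulrDr mulrA addrC.
- rewrite mulrBl -[nu * _ * mu]mulrA (intertwine_geo _ yvmu xmu).
  by rewrite mulrBr opprB -!mulrA [LHS]addrC -[LHS]addrA [- _ + _]addrC addrA.
Qed.

Section Eval2.
Variables (C : fieldType) (A : algType C) (x y : A).
Hypothesis xy : x * y = y * x.

(** This is the condition for [horner_morph] to be multiplicative: every coefficient, a polynomial
    in y, must commute with x. *)
Lemma comm_horner_alg : commr_rmorph (horner_alg y) x.
Proof.
move=> q; rewrite /GRing.comm; elim/poly_ind: q => [|q c IHq].
  by rewrite rmorph0 mul0r mulr0.
rewrite rmorphD rmorphM /= horner_algX horner_algC mulrDl mulrDr.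
by rewrite -scalerAr mulr1 -scalerAl mul1r -mulrA -xy !mulrA IHq.
Qed.

(** As a function of the polynomial, [eval2] is convertible to [ev], so it inherits the morphism
    lemmas by [exact]. *)
Let ev : {rmorphism {poly {poly C}} -> A} := horner_morph comm_horner_alg.

Lemma eval2X : eval2 'X x y = x.
Proof. by rewrite /eval2 map_polyX hornerX. Qed.

Lemma eval2Y : eval2 'X%:P x y = y.
Proof. by rewrite /eval2 map_polyC hornerC /= horner_algX. Qed.

Lemma eval2C c : eval2 c%:P%:P x y = c%:A.
Proof. by rewrite /eval2 map_polyC hornerC /= horner_algC. Qed.

Lemma eval2D p q : eval2 (p + q) x y = eval2 p x y + eval2 q x y.
Proof. exact: (rmorphD ev). Qed.

Lemma eval2_geo a b n :
  eval2 (geo a b n) x y = geo (eval2 a x y) (eval2 b x y) n.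
Proof. exact: (rmorph_geo ev). Qed.

Lemma eval2_geo2 u a b n :
  eval2 (geo2 u a b n) x y =
  geo2 (eval2 u x y) (eval2 a x y) (eval2 b x y) n.
Proof. exact: (rmorph_geo2 ev). Qed.

End Eval2.

Lemma tofrac_geo (D : idomainType) (x y p : D) n :
  x - y + p != 0 ->
  tofrac (geo (x + p) y n) = Gexpr n (tofrac x) (tofrac y) (tofrac p).
Proof.
move=> d_neq0; rewrite rmorph_geo rmorphD geo_closed //.
by rewrite -rmorphB -rmorphD /= tofrac_eq0.
Qed.

Lemma tofrac_geo2 (D : idomainType) (x y p v : D) n :
  2%:R != 0 :> D -> p + v = 2 -> x - y + p != 0 -> x - y - v != 0 ->
  tofrac (geo2 x (x + p + v) (y + v) n) =
  Fexpr n (tofrac x) (tofrac y) (tofrac p) (tofrac v).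
Proof.
move=> two_neq0 pv2 d1 d2; rewrite rmorph_geo2 !rmorphD geo2_closed //.
- by rewrite -(rmorph_nat (@tofrac D) 2) tofrac_eq0.
- by rewrite -rmorphD pv2 rmorph_nat.
- by rewrite -rmorphB -rmorphD /= tofrac_eq0.
- by rewrite -!rmorphB /= tofrac_eq0.
Qed.

(** Exchanging x with y and phi with varphi turns the two linear denominators into each other up to
    sign. *)
Lemma subBN_neq0 (V : zmodType) (a b c : V) :
  a - b + c != 0 -> b - a - c != 0.
Proof. by rewrite -oppr_eq0 opprD opprB. Qed.

(** In the outer variable X this is X - (Y - c), monic of degree one. *)
Lemma polyXBY_neq0 (R : nzRingType) (c : R) :
  'X - 'X%:P + c%:P%:P != 0 :> {poly {poly R}}.
Proof.
have -> : 'X - 'X%:P + c%:P%:P = 'X - ('X - c%:P)%:P :> {poly {poly R}}.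
  by rewrite polyCB opprB addrA addrAC.
by rewrite polyXsubC_eq0.
Qed.

Lemma bracketE (C : fieldType) (A : algType C) (a m : A) (c : C) :
  bracket a m = c *: m -> a * m = m * (a + c%:A).
Proof.
by rewrite /bracket mulrDr -scalerAr mulr1 => <-; rewrite addrC subrK.
Qed.

Lemma calM_expr (C : fieldType) (two_neq0 : 2%:R != 0 :> C) (A : algType C)
    (h1 h2 h phi vphi : C)
    (h_def : h = (h1 + h2) / 2) (h_neq0 : h != 0)
    (phi_def : phi = h1 / h) (vphi_def : vphi = h2 / h)
    (x mu nu y : A) (hM : calM h1 h2 (mx2 x mu nu y)) (n : nat) :
  exists F G Ft Gt : {poly {poly C}},
    [/\ tofrac F = Fexpr n (ratX _) (ratY _) (ratC phi) (ratC vphi),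
        tofrac G = Gexpr n (ratX _) (ratY _) (ratC phi),
        tofrac Ft = Fexpr n (ratY _) (ratX _) (ratC vphi) (ratC phi),
        tofrac Gt = Gexpr n (ratY _) (ratX _) (ratC vphi)
      & mx2 x mu nu y ^+ n =
        mx2 (x ^+ n - mu * nu * eval2 F x y) (mu * eval2 G x y)
            (nu * eval2 Gt x y) (y ^+ n - nu * mu * eval2 Ft x y)].
Proof.
have h12_neq0 : h1 + h2 != 0.
  by apply: contraNneq h_neq0 => h0; rewrite h_def h0 mul0r.
have phiE : 2 * h1 / (h1 + h2) = phi.
  by rewrite phi_def h_def; field; rewrite h12_neq0 two_neq0.
have vphiE : 2 * h2 / (h1 + h2) = vphi.
  by rewrite vphi_def h_def; field; rewrite h12_neq0 two_neq0.
have pv2 : phi + vphi = 2 by rewrite -phiE -vphiE; field.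
move: hM; rewrite /calM !mxE /= phiE vphiE.
case=> -[xmu ymu mu2] [[xnu ynu nu2] [xy munu]].
have {}xy : x * y = y * x by apply/eqP; rewrite -subr_eq0 xy.
have two0 : 2%:R != 0 :> {poly {poly C}} by rewrite -!polyC_natr !polyC_eq0.
have pv2P : phi%:P%:P + vphi%:P%:P = 2 :> {poly {poly C}}.
  by rewrite -!polyCD pv2 !polyC_natr.
have d1 := polyXBY_neq0 phi; have d1t := subBN_neq0 d1.
have d2 : 'X - 'X%:P - vphi%:P%:P != 0 :> {poly {poly C}}.
  by have := polyXBY_neq0 (- vphi); rewrite !polyCN.
have d2t := subBN_neq0 d2; rewrite opprK in d2t.
have comA (c : C) (m : A) : c%:A * m = m * c%:A.
  by rewrite -scalerAl mul1r -scalerAr mulr1.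
(* The recursions give honest polynomials; that their fractions are the closed forms expresses the
   exactness of the divisions. *)
exists (geo2 'X ('X + phi%:P%:P + vphi%:P%:P) ('X%:P + vphi%:P%:P) n),
  (geo ('X + phi%:P%:P) 'X%:P n),
  (geo2 'X%:P ('X%:P + vphi%:P%:P + phi%:P%:P) ('X + phi%:P%:P) n),
  (geo ('X%:P + vphi%:P%:P) 'X n).
split.
- exact: tofrac_geo2.
- exact: tofrac_geo.
- by apply: tofrac_geo2 => //; rewrite addrC.
- exact: tofrac_geo.
(* Evaluation commutes with the recursions, leaving the matrix identity in A with shifts [phi%:A]
   and [vphi%:A]. *)
rewrite !eval2_geo // !eval2_geo2 // !eval2D // !(eval2X, eval2Y, eval2C).
apply: expr_mx2; rewrite -?expr2 //; try exact: bracketE.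
by apply/eqP; rewrite -addr_eq0 munu.
Qed.

Theorem lemma4p3 (R : realType) (A : algType R[i])
    (h1 h2 h phi vphi : R[i])
    (h_def : h = (h1 + h2) / 2) (h_neq0 : h != 0)
    (phi_def : phi = h1 / h) (vphi_def : vphi = h2 / h)
    (x mu nu y : A) (hM : calM h1 h2 (mx2 x mu nu y))
    (n : nat) (n_gt0 : (0 < n)%N) :
  exists F G Ft Gt : {poly {poly R[i]}},
    [/\ tofrac F = Fexpr n (ratX _) (ratY _) (ratC phi) (ratC vphi),
        tofrac G = Gexpr n (ratX _) (ratY _) (ratC phi),
        tofrac Ft = Fexpr n (ratY _) (ratX _) (ratC vphi) (ratC phi),
        tofrac Gt = Gexpr n (ratY _) (ratX _) (ratC vphi)
      & mx2 x mu nu y ^+ n =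
        mx2 (x ^+ n - mu * nu * eval2 F x y) (mu * eval2 G x y)
            (nu * eval2 Gt x y) (y ^+ n - nu * mu * eval2 Ft x y)].
Proof.
apply: (@calM_expr _ _ A h1 h2 h) => //.
by rewrite Num.Theory.pnatr_eq0.
Qed.
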